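(* Let $n\ge 2$, let $k=k(t,n)$ be one of the digital adjacencies of $\mathbb{Z}^n$, and let $SC_k^{n,l}=(x_i)_{i\in\{0,\dots,l-1\}}$ be a simple closed $k$-curve with $l\ge 4$ elements in $\mathbb{Z}^n$. Equip $SC_k^{n,l}$ with the operations $x_i\ast_1 x_j=x_{i+j \,(\mathrm{mod}\, l)}$ and $x_i\star x_j=x_{i\cdot j\,(\mathrm{mod}\, l)}$. Then the commutative ring $(SC_k^{n,l},\ast_1,\star)$ is isomorphic, as a ring, to the ring $(\mathbb{Z}_l,+,\cdot)$ of integers modulo $l$.
   Context: For $1\le t\le n$, two distinct points of $\mathbb{Z}^n$ are $k(t,n)$-adjacent if at most $t$ of their coordinates differ by $\pm1$ and all the other coordinates coincide; the adjacency is named by the number $k=k(t,n)=\sum_{i=1}^{t}2^i\binom{n}{i}$. A simple closed $k$-curve with $l$ elements in $\mathbb{Z}^n$ ($l\ge 4$, $n\ge 2$), denoted $SC_k^{n,l}$, is a sequence $(x_i)_{i\in\{0,\dots,l-1\}}$ of $l$ distinct points of $\mathbb{Z}^n$ such that $x_i$ and $x_j$ are $k$-adjacent if and only if $i-j\equiv\pm1\pmod l$. In $x_{i+j\,(\mathrm{mod}\,l)}$ and $x_{i\cdot j\,(\mathrm{mod}\,l)}$ the index is reduced to its representative in $\{0,\dots,l-1\}$. *)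

(* Defs.v *)
From HB Require Import structures.
From mathcomp Require Import all_boot all_order all_algebra.

Set Implicit Arguments.
Unset Strict Implicit.
Unset Printing Implicit Defensive.

Import GRing.Theory.
Local Open Scope ring_scope.

(* The number k(t,n) = \sum_(1 <= i <= t) 2^i 'C(n, i). *)
Definition adj_number (t n : nat) : nat :=
  (\sum_(1 <= i < t.+1) 2 ^ i * 'C(n, i))%N.

Definition unit_diff (n : nat) (p q : 'rV[int]_n) : {set 'I_n} :=
  [set c | (p 0 c - q 0 c == 1) || (p 0 c - q 0 c == -1)].

Definition t_adjacent (n t : nat) (p q : 'rV[int]_n) : bool :=
  [&& p != q, (#|unit_diff p q| <= t)%N
    & [forall c, (c \notin unit_diff p q) ==> (p 0 c == q 0 c)]].

(* An adjacency of Z^n is named by its number k; since k(t,n) is strictly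
   increasing in t on 1 <= t <= n, the number determines t: see
   [k_adjacentE] below. *)
Definition k_adjacent (n k : nat) (p q : 'rV[int]_n) : Prop :=
  exists t, [/\ (1 <= t <= n)%N, k = adj_number t n & t_adjacent t p q].

Lemma adj_number_lt n t u :
  (t < u)%N -> (u <= n)%N -> (adj_number t n < adj_number u n)%N.
Proof.
move=> tu un; rewrite /adj_number [X in (_ < X)%N](big_cat_nat _ (n := t.+1)) //=.
rewrite -[X in (X < _)%N]addn0 ltn_add2l big_nat_recr //=.
  by rewrite addn_gt0 orbC muln_gt0 expn_gt0 bin_gt0 un.
exact: ltnW.
Qed.

Lemma k_adjacentE n t (p q : 'rV[int]_n) : (1 <= t <= n)%N ->
  k_adjacent (adj_number t n) p q <-> t_adjacent t p q.
Proof.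
move=> tn; split=> [[u [/andP[_ un] e a]]|a]; last by exists t.
case/andP: tn => _ tn; case: (ltngtP t u) => [lt|lt|->//].
  by have := adj_number_lt lt un; rewrite e ltnn.
by have := adj_number_lt lt tn; rewrite e ltnn.
Qed.

Record sc_curve (n k l : nat) := SCCurve {
  sc_fun :> 'I_l -> 'rV[int]_n;
  sc_dim : (2 <= n)%N;
  sc_length : (4 <= l)%N;
  sc_inj : injective sc_fun;
  sc_adj : forall i j : 'I_l,
    k_adjacent k (sc_fun i) (sc_fun j) <->
    (i%:Z - j%:Z = 1 %[mod l%:Z])%Z \/ (i%:Z - j%:Z = -1 %[mod l%:Z])%Z }.

Section CurveRing.

Variables (n k l : nat) (X : sc_curve n k l).

(* The underlying set of the curve, as a subtype of Z^n. *)
Definition sc_point := {p : 'rV[int]_n | p \in codom X}.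

HB.instance Definition _ := Choice.on sc_point.

Definition sc_elt (i : 'I_l) : sc_point := exist _ (X i) (codom_f X i).

Definition sc_idx (p : sc_point) : 'I_l := iinv (valP p).

Fact sc_length_gt0 : (0 < l)%N.
Proof. exact: leq_trans (sc_length X). Qed.

(* The point x_(m mod l). *)
Definition sc_at (m : nat) : sc_point :=
  sc_elt (Ordinal (ltn_pmod m sc_length_gt0)).

Definition sc_add (p q : sc_point) : sc_point := sc_at (sc_idx p + sc_idx q).
Definition sc_mul (p q : sc_point) : sc_point := sc_at (sc_idx p * sc_idx q).
Definition sc_opp (p : sc_point) : sc_point := sc_at (l - sc_idx p).

Lemma sc_eltK : cancel sc_elt sc_idx.
Proof. by move=> i; apply: (@sc_inj _ _ _ X); rewrite /sc_idx f_iinv. Qed.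

Lemma sc_idxK : cancel sc_idx sc_elt.
Proof. by move=> p; apply: val_inj; rewrite /= /sc_idx f_iinv. Qed.

Lemma sc_idx_at m : sc_idx (sc_at m) = (m %% l)%N :> nat.
Proof. by rewrite /sc_at sc_eltK. Qed.

Lemma sc_at_mod m1 m2 : m1 = m2 %[mod l] -> sc_at m1 = sc_at m2.
Proof. by move=> e; congr sc_elt; apply: val_inj. Qed.

Lemma sc_at_idx p : sc_at (sc_idx p) = p.
Proof.
rewrite -[RHS]sc_idxK; congr sc_elt.
by apply: val_inj; rewrite /= modn_small.
Qed.

Fact sc_addA : associative sc_add.
Proof.
move=> p q r; apply: sc_at_mod.
by rewrite !sc_idx_at modnDmr modnDml addnA.
Qed.

Fact sc_addC : commutative sc_add.
Proof. by move=> p q; rewrite /sc_add addnC. Qed.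

Fact sc_add0 : left_id (sc_at 0) sc_add.
Proof. by move=> p; rewrite /sc_add sc_idx_at mod0n sc_at_idx. Qed.

Fact sc_addN : left_inverse (sc_at 0) sc_opp sc_add.
Proof.
move=> p; apply: sc_at_mod; rewrite sc_idx_at modnDml subnK ?modnn ?mod0n //.
exact: ltnW.
Qed.

HB.instance Definition _ :=
  GRing.isZmodule.Build sc_point sc_addA sc_addC sc_add0 sc_addN.

Fact sc_mulA : associative sc_mul.
Proof.
move=> p q r; apply: sc_at_mod.
by rewrite !sc_idx_at modnMmr modnMml mulnA.
Qed.

Fact sc_mulC : commutative sc_mul.
Proof. by move=> p q; rewrite /sc_mul mulnC. Qed.

Fact sc_mul1 : left_id (sc_at 1) sc_mul.
Proof.
move=> p; rewrite -[RHS]sc_at_idx; apply: sc_at_mod.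
by rewrite sc_idx_at modnMml mul1n.
Qed.

Fact sc_mulDl : left_distributive sc_mul sc_add.
Proof.
move=> p q r; apply: sc_at_mod.
by rewrite !sc_idx_at modnMml modnDm mulnDl.
Qed.

Fact sc_1_neq0 : sc_at 1 != sc_at 0.
Proof.
apply/eqP => /(congr1 (fun p => val (sc_idx p))) /=.
by rewrite !sc_idx_at mod0n modn_small // (leq_trans _ (sc_length X)).
Qed.

HB.instance Definition _ := GRing.Zmodule_isComNzRing.Build sc_point
  sc_mulA sc_mulC sc_mul1 sc_mulDl sc_1_neq0.

Lemma sc_addE (i j : 'I_l) : sc_elt i + sc_elt j = sc_at (i + j)%N.
Proof. by rewrite -[LHS]/(sc_add _ _) /sc_add !sc_eltK. Qed.

Lemma sc_mulE (i j : 'I_l) : sc_elt i * sc_elt j = sc_at (i * j)%N.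
Proof. by rewrite -[LHS]/(sc_mul _ _) /sc_mul !sc_eltK. Qed.

End CurveRing.

(* Main.v *)
Require Import Defs.
From mathcomp Require Import all_boot all_order all_algebra.
From HB Require Import structures.

Import GRing.Theory.

(** The map [x_i] to [i] modulo [l] is the isomorphism: sums and products on the curve are computed
    on indices and then reduced modulo [l], a reduction that casting to ['Z_l] ignores
    ([sc_toZp_at]). Its inverse sends [z] to [x_z]. *)

Section CurveToZp.

Variables (n k l : nat) (X : sc_curve n k l).

Definition sc_toZp (p : sc_point X) : 'Z_l := ((sc_idx p)%:R)%R.

(** ['Z_l] has modulus [l] only when [l > 1]; this closes the side conditions of the [Zp] lemmas. *)
Let l_gt1 : (1 < l)%N.
Proof. exact: leq_trans (sc_length X). Qed.

Lemma sc_toZp_at m : sc_toZp (sc_at X m) = (m%:R)%R.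
Proof. by rewrite /sc_toZp sc_idx_at Zp_nat_mod. Qed.

Fact sc_toZp_monoid_morphism : monoid_morphism sc_toZp.
Proof.
split=> [|p q]; first exact: (sc_toZp_at 1).
(* By conversion, [p * q] is [sc_at] of the product of the indices. *)
by rewrite [LHS](sc_toZp_at (sc_idx p * sc_idx q)) natrM.
Qed.

Fact sc_toZp_nmod_morphism : nmod_morphism sc_toZp.
Proof.
split=> [|p q]; first exact: (sc_toZp_at 0).
by rewrite [LHS](sc_toZp_at (sc_idx p + sc_idx q)) natrD.
Qed.

HB.instance Definition _ :=
  GRing.isNmodMorphism.Build (sc_point X) 'Z_l sc_toZp sc_toZp_nmod_morphism.
HB.instance Definition _ :=
  GRing.isMonoidMorphism.Build (sc_point X) 'Z_l sc_toZp
    sc_toZp_monoid_morphism.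

Lemma sc_toZp_bij : bijective sc_toZp.
Proof.
exists (fun z : 'Z_l => sc_at X z) => [p|z]; last by rewrite sc_toZp_at natr_Zp.
(* With both sides of the form [sc_at], a congruence of indices suffices. *)
by rewrite -[RHS]sc_at_idx; apply: sc_at_mod; rewrite val_Zp_nat ?modn_mod.
Qed.

End CurveToZp.

Theorem theorem4p5 (n t l : nat) (hn : (2 <= n)%N) (ht : (1 <= t <= n)%N)
    (hl : (4 <= l)%N) (X : sc_curve n (adj_number t n) l) :
  exists f : {rmorphism sc_point X -> 'Z_l}, bijective f.
Proof. by exists (@sc_toZp _ _ _ X); apply: sc_toZp_bij. Qed.
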